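(* Let $n\ge 1$ and $\Sigma=\{0,1\}$. Let $\mathring{R}_{n+1}$ be the set of all non-empty circularly representable subsets of $\Sigma^{n+1}$. Then $$|\mathring{R}_{n+1}| \;\le\; 10^{2^{n-1}}.$$
   Context: $\Sigma=\{0,1\}$. For a non-empty word $w$ over $\Sigma$ and $m\ge 1$, $C_m(w)$ denotes the set of length-$m$ factors of $w$ when $w$ is interpreted circularly, i.e. the set of words $w[i]w[i+1]\cdots w[i+m-1]$ for $1\le i\le |w|$, with indices taken modulo $|w|$. A subset $S\subseteq\Sigma^m$ is circularly representable if there is a non-empty word $w$ with $C_m(w)=S$ (one says $w$ circularly witnesses $S$). $\mathring{R}_m$ is the set of all non-empty circularly representable subsets of $\Sigma^m$. *)

(* Defs.v *)
From mathcomp Require Import all_boot.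
From mathcomp Require Import boolp.

Set Implicit Arguments.
Unset Strict Implicit.
Unset Printing Implicit Defensive.

(** The alphabet {0,1} is [bool] ([false] is 0, [true] is 1),
    words are [seq bool], and Sigma^m is the finite type [m.-tuple bool]. *)

(** Positions are counted from 0, so [i] and all indices range over residues
    modulo [size w]. The word may be shorter than [m], in which case the
    factor wraps around several times. The default [false] of [nth] is never
    reached when [w] is non-empty. *)
Definition circ_factor (m : nat) (w : seq bool) (i : nat) : m.-tuple bool :=
  [tuple nth false w ((i + j) %% size w) | j < m].

Definition circ_factors (m : nat) (w : seq bool) : {set m.-tuple bool} :=
  [set circ_factor m w i | i : 'I_(size w)].

Definition circ_witnesses (m : nat) (w : seq bool) (S : {set m.-tuple bool}) :
    Prop :=
  w <> [::] /\ circ_factors m w = S.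

Definition circ_representable (m : nat) (S : {set m.-tuple bool}) : Prop :=
  exists w : seq bool, circ_witnesses w S.

(** The existential ranges over words of unbounded length, so it is turned
    into a boolean by classical reflection. *)
Definition circ_representable_sets (m : nat) : {set {set m.-tuple bool}} :=
  [set S | (S != set0) && `[< circ_representable S >]].

(* Main.v *)
Require Import Defs.
From mathcomp Require Import all_boot.
From mathcomp Require Import boolp.

(** View the elements of [S] as edges of the de Bruijn graph on words of length
    [n]. The edges [a x b] with fixed middle part [x] of length [n - 1] form a
    2x2 block, recording which of the two sources [a x] is joined to which of
    the two targets [x b]. If [S] is circularly representable, a vertex has an
    outgoing edge in [S] iff it has an incoming one. Hence the row supports of
    all the blocks determine the column supports of all the blocks. With both
    supports known, a block is determined unless all rows and columns are
    non-empty, in which case there are 7 possibilities. So it suffices to record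
    for each block one of 3 row supports (when some row is empty) or one of 7
    full blocks: 10 codes for each of the [2 ^ (n - 1)] blocks. *)

Definition block := (bool * bool * bool * bool)%type.

(* The block [(a, b, c, d)] has rows [a b] and [c d]. When both rows but only one
   column are non-empty, any fixed code with two non-empty rows would do. *)
Definition block_code (p : block) : block :=
  let: (a, b, c, d) := p in
  if (a || b) && (c || d) then
    if (a || c) && (b || d) then p else (true, true, true, true)
  else (a || b, false, c || d, false).

Definition row_support (p : block) :=
  let: (a, b, c, d) := p in (a || b, c || d).

Definition col_support (p : block) :=
  let: (a, b, c, d) := p in (a || c, b || d).

Lemma card_block_codes : #|[set block_code p | p : block]| <= 10.
Proof.
(* First the seven blocks without an empty row or column, then the codes of the three row supports
   with an empty row. *)
pose s : seq block := [:: (true, true, true, true);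
  (true, true, true, false); (true, true, false, true);
  (true, false, true, true); (false, true, true, true);
  (true, false, false, true); (false, true, true, false);
  (true, false, false, false); (false, false, true, false);
  (false, false, false, false)].
have code_s p : block_code p \in s by move: p => [[[[] []] []] []].
apply: leq_trans (card_size s); apply/subset_leq_card/subsetP.
by move=> _ /imsetP[p _ ->].
Qed.

Lemma block_code_row_support {p q} :
  block_code p = block_code q -> row_support p = row_support q.
Proof. by move: p q => [[[[] []] []] []] [[[[] []] []] []]. Qed.

(** If at most one row is non-empty, that row equals the column support. The only code shared by
    blocks with two non-empty rows is the all-[true] one; its three preimages have distinct column
    supports. *)
Lemma block_code_inj p q :
  block_code p = block_code q -> col_support p = col_support q -> p = q.
Proof. by move: p q => [[[[] []] []] []] [[[[] []] []] []]. Qed.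

Lemma existsb_bool (P : pred bool) : [exists b, P b] = P false || P true.
Proof.
apply/existsP/orP => [[[] Pb]|[Pb|Pb]]; [by right|by left| |].
- by exists false.
- by exists true.
Qed.

Section DeBruijn.
Context {m : nat}.
Implicit Types (S : {set m.+1.-tuple bool}) (v : m.-tuple bool).

Definition has_out S v := [exists b, rcons_tuple v b \in S].
Definition has_in S v := [exists a, cons_tuple a v \in S].

Lemma nth_circ_factor w i j : j < m ->
  nth false (circ_factor m w i) j = nth false w ((i + j) %% size w).
Proof. by move=> jm; rewrite (nth_mktuple _ _ (Ordinal jm)). Qed.

End DeBruijn.

Lemma circ_factorS m w i :
  circ_factor m.+1 w i =
  cons_tuple (nth false w (i %% size w)) (circ_factor m w i.+1).
Proof.
apply/val_inj/(@eq_from_nth _ false) => [|j]; rewrite !size_tuple // => jm.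
rewrite nth_circ_factor //; case: j jm => [|j] jm /=; first by rewrite addn0.
by rewrite nth_circ_factor // addSnnS.
Qed.

Lemma circ_factorSr m w i :
  circ_factor m.+1 w i =
  rcons_tuple (circ_factor m w i) (nth false w ((i + m) %% size w)).
Proof.
apply/val_inj/(@eq_from_nth _ false) => [|j]; rewrite !size_tuple // => jm.
rewrite nth_circ_factor // nth_rcons size_tuple.
move: jm; rewrite ltnS leq_eqVlt => /predU1P[->|jm]; first by rewrite ltnn eqxx.
by rewrite jm nth_circ_factor.
Qed.

Lemma circ_factor_modn m w i :
  circ_factor m w (i %% size w) = circ_factor m w i.
Proof. by apply: eq_from_tnth => j; rewrite !tnth_mktuple modnDml. Qed.

Lemma mem_circ_factor m w i : w != [::] -> circ_factor m w i \in circ_factors m w.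
Proof.
rewrite -size_eq0 -lt0n => w0; rewrite -circ_factor_modn.
by apply/imsetP; exists (Ordinal (ltn_pmod i w0)).
Qed.

Lemma has_out_circ_factors m w v : w != [::] ->
  has_out (circ_factors m.+1 w) v = (v \in circ_factors m w).
Proof.
move=> w0; apply/existsP/imsetP => [[b /imsetP[i _]]|[i _ ->]].
  rewrite circ_factorSr => /(congr1 val) /= /rcons_inj[vE _].
  by exists i => //; apply: val_inj.
exists (nth false w ((i + m) %% size w)).
by rewrite -circ_factorSr; apply: mem_circ_factor.
Qed.

Lemma has_in_circ_factors m w v : w != [::] ->
  has_in (circ_factors m.+1 w) v = (v \in circ_factors m w).
Proof.
move=> w0; apply/existsP/imsetP => [[a /imsetP[i _]]|[i _ ->]].
  rewrite circ_factorS => /(congr1 val) /= [_ vE].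
  have -> : v = circ_factor m w i.+1 by apply: val_inj.
  exact/imsetP/mem_circ_factor.
(* The position before [i] is written [i + (size w).-1], since [i.-1] would not wrap around at 0. *)
have -> : circ_factor m w i = circ_factor m w (i + (size w).-1).+1.
  rewrite -[RHS]circ_factor_modn -addnS prednK ?lt0n ?size_eq0 //.
  by rewrite modnDr circ_factor_modn.
exists (nth false w ((i + (size w).-1) %% size w)).
by rewrite -circ_factorS; apply: mem_circ_factor.
Qed.

(** In a circular word every occurrence of [v] has a letter before it and a letter after it, so both
    sides amount to [v] being a factor of the witness. *)
Lemma circ_representable_balanced m (S : {set m.+1.-tuple bool}) v :
  circ_representable S -> has_out S v = has_in S v.
Proof.
case=> w [/eqP w0 <-].
by rewrite has_out_circ_factors // has_in_circ_factors.
Qed.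

Section Blocks.
Context {k : nat}.
Implicit Types (S T : {set k.+2.-tuple bool}) (x : k.-tuple bool).

Definition edge a x b : k.+2.-tuple bool := cons_tuple a (rcons_tuple x b).

Lemma edgeE a x b : edge a x b = rcons_tuple (cons_tuple a x) b.
Proof. exact: val_inj. Qed.

Lemma edge_surj t : exists a x b, t = edge a x b.
Proof.
case/tupleP: t => a t; exists a.
have sz : size (belast (thead t) (behead t)) == k.
  by rewrite size_belast size_behead size_tuple.
exists (Tuple sz), (last (thead t) (behead t)).
apply: val_inj; rewrite /= -lastI; congr cons.
by rewrite {1}(tuple_eta t).
Qed.

Definition block_at S x : block :=
  (edge false x false \in S, edge false x true \in S,
   edge true x false \in S, edge true x true \in S).

Lemma row_support_block_at S x :
  row_support (block_at S x) =
  (has_out S (cons_tuple false x), has_out S (cons_tuple true x)).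
Proof. by rewrite /has_out !existsb_bool -!edgeE. Qed.

Lemma col_support_block_at S x :
  col_support (block_at S x) =
  (has_in S (rcons_tuple x false), has_in S (rcons_tuple x true)).
Proof. by rewrite /has_in !existsb_bool. Qed.

Lemma block_at_inj S T : block_at S =1 block_at T -> S = T.
Proof.
move=> ST; apply/setP => t; have [a [x [b ->]]] := edge_surj t.
by case: (ST x) => *; case: a; case: b.
Qed.

Definition set_code S : {ffun k.-tuple bool -> block} :=
  [ffun x => block_code (block_at S x)].

Lemma set_code_inj :
  {in circ_representable_sets k.+2 &, injective set_code}.
Proof.
move=> S T; rewrite !inE => /andP[_ /asboolP repS] /andP[_ /asboolP repT] /ffunP ST.
have codeST x : block_code (block_at S x) = block_code (block_at T x).
  by have := ST x; rewrite !ffunE.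
have outST v : has_out S v = has_out T v.
  case/tupleP: v => a x.
  have := block_code_row_support (codeST x).
  by rewrite !row_support_block_at => -[]; case: a.
(* A column of one block is, as a vertex, a row of a possibly different block, so [outST] is needed
   at all vertices before any column support is known. *)
have inST v : has_in S v = has_in T v.
  by rewrite -!circ_representable_balanced.
apply: block_at_inj => x; apply: block_code_inj => //.
by rewrite !col_support_block_at !inST.
Qed.

Lemma card_circ_representable_sets :
  #|circ_representable_sets k.+2| <= 10 ^ 2 ^ k.
Proof.
rewrite -(card_in_imset set_code_inj).
pose codes := [set block_code p | p : block].
apply: (@leq_trans #|@ffun_on_mem (k.-tuple bool) block (mem codes)|).
  apply/subset_leq_card/subsetP => _ /imsetP[S _ ->].
  by apply/ffun_onP => x; rewrite ffunE; apply: imset_f.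
rewrite card_ffun_on card_tuple card_bool.
by rewrite leq_exp2r ?expn_gt0 // card_block_codes.
Qed.

End Blocks.

Theorem proposition12 (n : nat) (hn : 1 <= n) :
  #|circ_representable_sets n.+1| <= 10 ^ (2 ^ (n - 1)).
Proof.
by case: n hn => // k _; rewrite subn1; apply: card_circ_representable_sets.
Qed.
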